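(* Let $\alpha\in(0,1)$ and assume that $\rho_r$ is real for every $r\in\{0,\ldots,q-1\}^d$. Define a complex Gaussian field on $\{0,1,\ldots,q-1\}^d$ by $$g_x=\frac{1}{\sqrt{q^d}}\sum_{r\in\{0,\ldots,q-1\}^d}\frac{1}{\sqrt{1+\frac{\alpha}{1-\alpha}(1-\rho_r)}}\;\theta_1^{x\cdot r}\,\gamma_r,$$ where $(\gamma_r)$ are i.i.d. standard Gaussian random variables. Then $(g_x)$ has covariance function $$\mathrm{Cov}(g_x,g_y)=\mathbb{E}[g_x\overline{g_y}]=(1-\alpha)G(x,y;\alpha)=\frac{1}{q^d}\sum_{r\in\{0,\ldots,q-1\}^d}\frac{1}{1+\frac{\alpha}{1-\alpha}(1-\rho_r)}\,\theta_1^{(x-y)\cdot r}$$ for all $x,y\in\{0,1,\ldots,q-1\}^d$.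
   Context: Let $q\ge2$, $d\ge1$ be integers, $\theta_1=e^{2\pi i/q}$, $x\cdot r=\sum_{k=1}^dx[k]r[k]$. Let $V$ be a random variable with values in $\{0,\ldots,q-1\}^d$ and $\rho_r=\mathbb{E}[\theta_1^{V\cdot r}]$. The random walk is $X_{t+1}=X_t+Z_t\bmod q$ (entrywise), $t=0,1,2,\ldots$, with $(Z_t)$ i.i.d. distributed as $V$ and independent of $X_0$, and $G(x,y;\alpha)=\sum_{t=0}^\infty\alpha^t\,\mathbb{P}(X_t=y\mid X_0=x)$. *)

(* Defs.v *)
From HB Require Import structures.
From mathcomp Require Import all_boot all_order all_algebra.
From mathcomp Require Import all_classical all_reals all_analysis.
From mathcomp Require Import complex.

Set Implicit Arguments.
Unset Strict Implicit.
Unset Printing Implicit Defensive.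

Import Order.TTheory GRing.Theory Num.Theory.
Import numFieldNormedType.Exports.

Local Open Scope classical_set_scope.
Local Open Scope ring_scope.

(* {0, ..., q-1}^d with entrywise addition mod q. The encoding is meant for
   q >= 2 only: 'Z_0 and 'Z_1 are the integers mod 2. *)
Definition site (q d : nat) : Type := 'rV['Z_q]_d.

HB.instance Definition _ q d := Finite.on (site q d).
HB.instance Definition _ q d := GRing.Zmodule.on (site q d).
HB.instance Definition _ q d := isPointed.Build (site q d) 0.
HB.instance Definition _ q d := @isMeasurable.Build default_measure_display
  (site q d) discrete_measurable discrete_measurable0
  discrete_measurableC discrete_measurableU.

(* The representative with entries in {0, ..., q-1}, as an integer vector:
   differences of representatives are not reduced mod q. *)
Definition zrep q d (x : site q d) : 'rV[int]_d :=
  \row_k (nat_of_ord (x ord0 k))%:Z.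

Definition dot d (u v : 'rV[int]_d) : int :=
  \sum_k u ord0 k * v ord0 k.

(* e^(2 i pi / q) *)
Definition theta1 (R : realType) (q : nat) : R[i] :=
  Complex (cos (2 * pi / q%:R)) (sin (2 * pi / q%:R)).

Section complex_expectation.
Context d (T : measurableType d) (R : realType) (P : probability T R).
Implicit Types Z W : T -> R[i].

Definition cintegrable Z : Prop :=
  P.-integrable [set: T] (EFin \o (fun w => complex.Re (Z w))) /\
  P.-integrable [set: T] (EFin \o (fun w => complex.Im (Z w))).

(* E[Re Z] + i E[Im Z]; meaningful when Z is cintegrable. *)
Definition cexpectation Z : R[i] :=
  Complex (fine 'E_P[fun w => complex.Re (Z w)]) (fine 'E_P[fun w => complex.Im (Z w)]).

Definition ccovariance Z W : R[i] :=
  cexpectation (fun w => (Z w - cexpectation Z) * (W w - cexpectation W)^*%C).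

End complex_expectation.

Section independence.
Context d (T : measurableType d) (R : realType) (P : probability T R).

Definition independent_RVs (I : eqType) d' (T' : measurableType d')
    (X : I -> {RV P >-> T'}) : Prop :=
  forall (J : seq I) (A : I -> set T'), uniq J ->
    (forall j, measurable (A j)) ->
    P (\bigcap_(j in [set` J]) (X j @^-1` A j)) =
    (\prod_(j <- J) P (X j @^-1` A j))%E.

Definition g_sigma_algebra_family (I : Type) d' (T' : measurableType d')
    (Z : I -> {RV P >-> T'}) : set (set T) :=
  <<s \bigcup_(i in [set: I]) g_sigma_algebra_preimage (Z i) >>.

Definition independent_of_family (I : Type) d1 (T1 : measurableType d1)
    d2 (T2 : measurableType d2)
    (X : {RV P >-> T1}) (Z : I -> {RV P >-> T2}) : Prop :=
  forall (A : set T1) (B : set T), measurable A ->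
    g_sigma_algebra_family Z B ->
    P (X @^-1` A `&` B) = (P (X @^-1` A) * P B)%E.

(* P(A | B); only meaningful when P B != 0. *)
Definition cond_prob (A B : set T) : R := fine (P (A `&` B)) / fine (P B).

End independence.

Section random_walk.
Context (R : realType) (q n : nat).
Context d0 (T0 : measurableType d0) (P0 : probability T0 R).
Variable V : {RV P0 >-> site q n}.

Definition rho (r : site q n) : R[i] :=
  cexpectation P0 (fun w => theta1 R q ^ dot (zrep (V w)) (zrep r)).

Context d1 (T1 : measurableType d1) (P1 : probability T1 R).

Record random_walk (X Z : nat -> {RV P1 >-> site q n}) : Prop := RandomWalk {
  walk_step : forall t w, X t.+1 w = X t w + Z t w ;
  walk_distr : forall t (A : set (site q n)), measurable A ->
    distribution P1 (Z t) A = distribution P0 V A ;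
  walk_indep : independent_RVs Z ;
  walk_indep0 : independent_of_family (X 0%N) Z }.

Definition Green (X : nat -> {RV P1 >-> site q n}) (alpha : R)
    (x y : site q n) : R :=
  limn (series (fun t : nat =>
    alpha ^+ t * cond_prob P1 (X t @^-1` [set y]) (X 0%N @^-1` [set x]))).

End random_walk.

Section gaussian_field.
Context (R : realType) (q n : nat).
Context d (T : measurableType d) (P : probability T R).

Definition iid_standard_gaussian (I : eqType) (gamma : I -> {RV P >-> R}) :
    Prop :=
  independent_RVs gamma /\
  forall i (A : set R), measurable A ->
    distribution P (gamma i) A = normal_prob 0 1 A.

Definition weight (alpha : R) (z : R[i]) : R[i] :=
  1 + (alpha / (1 - alpha))%:C%C * (1 - z).

(* rh stands for the function r |-> rho_r. The root sqrtC is the usual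
   nonnegative one on nonnegative numbers. *)
Definition gfield (alpha : R) (rh : site q n -> R[i])
    (gamma : site q n -> {RV P >-> R}) (x : site q n) (w : T) : R[i] :=
  (sqrtC ((q ^ n)%:R : R[i]))^-1 *
  \sum_(r : site q n)
    (sqrtC (weight alpha (rh r)))^-1
    * theta1 R q ^ dot (zrep x) (zrep r)
    * (gamma r w)%:C%C.

End gaussian_field.

(* Main.v *)
Require Import Defs.
From HB Require Import structures.
From mathcomp Require Import all_boot all_order all_algebra.
From mathcomp Require Import all_classical all_reals all_analysis.
From mathcomp Require Import complex.
From mathcomp Require Import measurable_realfun.
From mathcomp Require Import ring lra.

Set Implicit Arguments.
Unset Strict Implicit.
Unset Printing Implicit Defensive.

Import Order.TTheory GRing.Theory Num.Theory.
Import numFieldNormedType.Exports.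

Local Open Scope classical_set_scope.
Local Open Scope ring_scope.

(** Write chi_r(x) = theta_1^(x . r) for the characters of the group of sites.

    The field g is a finite linear combination of the gamma_r, so E[g_x conj(g_y)]
    expands over pairs (r, s), and E[gamma_r gamma_s] = delta_(r,s) leaves only
    the diagonal
      q^-n sum_r w_r^(-1/2) conj(w_r^(-1/2)) chi_r(x) conj(chi_r(y)),
    where w_r is the weight 1 + alpha / (1 - alpha) (1 - rho_r).  As rho_r is
    real and |rho_r| <= 1, w_r is nonnegative, its square root is real, and
    [gaussian_lincomb_covariance] gives the Fourier formula.  The moments of
    gamma_r come from the density: integration by parts for the variance,
    parity for the mean, and Fubini for the product of two distinct ones.

    For the Green function, convolution with the law of V multiplies the r-th
    Fourier coefficient by rho_r, hence
      P(X_t = y | X_0 = x) = q^-n sum_r rho_r^t chi_r(x - y)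
    ([walk_cylinder], [transition_prob]).  Summing the geometric series in
    alpha rho_r and using
      (1 - alpha) / (1 - alpha rho_r) = 1 / w_r
    gives the same Fourier formula ([Green_fourier]). *)

(** * Characters of the group of sites *)

Section characters.
Context (R : realType) (q d : nat).
Hypothesis q_gt1 : (2 <= q)%N.

Lemma theta1X (m : nat) : theta1 R q ^+ m =
  Complex (cos (2 * pi / q%:R *+ m)) (sin (2 * pi / q%:R *+ m)).
Proof.
elim: m => [|m IH]; first by rewrite expr0 mulr0n cos0 sin0.
rewrite exprS IH [_ *+ m.+1]mulrS cosD sinD /theta1; simpc; congr Complex.
by rewrite addrC.
Qed.

(** The powers of theta_1 are points of the unit circle; if theta_1^m = 1 with
    0 < m < q, then cos (2 t) = 1 - 2 sin^2 t at t = pi m / q contradicts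
    sin t > 0. *)
Lemma theta1_prim : q.-primitive_root (theta1 R q).
Proof.
have q0 : q%:R != 0 :> R by rewrite pnatr_eq0 -lt0n ltnW.
apply/andP; split; first exact: ltnW.
apply/forallP => i; apply/eqP; rewrite unity_rootE theta1X eq_complex /=.
have [->|iq] := eqVneq i.+1 q.
  by rewrite -mulr_natr divfK// mulr_natl cos2pi sin2pi !eqxx.
(* half of the angle lies strictly between 0 and pi, where the sine is positive *)
suff s0 : 0 < sin (pi / q%:R *+ i.+1) :> R.
  apply/negbTE; rewrite negb_and; apply/orP; left.
  have -> : 2 * pi / q%:R *+ i.+1 = (pi / q%:R *+ i.+1) *+ 2 :> R.
    by rewrite -!mulrA mulr_natl mulrnAC.
  rewrite cos_mulr2n cos2sin2 lt_eqF//.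
  have := exprn_gt0 2 s0; lra.
have lt_iq : (i.+1 < q)%N by rewrite ltn_neqAle iq ltn_ord.
apply: sin_gt0_pi; apply/andP; split.
  by rewrite pmulrn_rgt0// divr_gt0 ?pi_gt0// ltr0n ltnW.
rewrite -mulr_natr mulrAC ltr_pdivrMr ?ltr0n ?(ltnW q_gt1)//.
by rewrite ltr_pM2l ?pi_gt0// ltr_nat.
Qed.

Definition chi (z r : site q d) : R[i] := theta1 R q ^ dot (zrep z) (zrep r).

Lemma theta1_neq0 : theta1 R q != 0.
Proof. by rewrite (prim_root_eq0 theta1_prim) -lt0n ltnW. Qed.

Lemma conj_theta1 : (theta1 R q)^*%C = (theta1 R q)^-1.
Proof.
apply: (mulfI theta1_neq0); rewrite mulfV ?theta1_neq0// /theta1; simpc.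
by rewrite -!expr2 cos2Dsin2 mulrC addNr.
Qed.

(** The exponent only involves representatives in [0, q), hence a product of
    natural powers, in which reduction mod q is harmless. *)
Lemma chiE z r : chi z r = \prod_k (theta1 R q ^+ r ord0 k) ^+ z ord0 k.
Proof.
rewrite /chi /dot (_ : \sum_k _ = (\sum_k z ord0 k * r ord0 k)%N%:Z).
  rewrite -exprnP -prodrXr; apply: eq_bigr => k _.
  by rewrite mulnC exprM.
rewrite (big_morph Posz PoszD (erefl _)); apply: eq_bigr => k _.
by rewrite !mxE PoszM.
Qed.

Lemma chiC z r : chi z r = chi r z.
Proof. by rewrite /chi; congr (_ ^ _); apply: eq_bigr => k _; rewrite mulrC. Qed.

Lemma chiDl u v r : chi (u + v) r = chi u r * chi v r.
Proof.
rewrite !chiE -big_split; apply: eq_bigr => k _ /=.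
have theta1q : theta1 R q ^+ (Zp_trunc q).+2 = 1.
  by rewrite Zp_cast// (prim_expr_order theta1_prim).
by rewrite mxE -exprD expr_mod// -exprM mulnC exprM theta1q expr1n.
Qed.

Lemma chi0l r : chi 0 r = 1.
Proof. by rewrite chiE big1// => k _; rewrite mxE expr0. Qed.

Lemma chi_neq0 z r : chi z r != 0.
Proof. by rewrite expfz_neq0// theta1_neq0. Qed.

Lemma chiNl z r : chi (- z) r = (chi z r)^-1.
Proof.
apply: (mulfI (chi_neq0 z r)); rewrite mulfV ?chi_neq0//.
by rewrite -chiDl subrr chi0l.
Qed.

Lemma chiDr z r s : chi z (r + s) = chi z r * chi z s.
Proof. by rewrite chiC chiDl !(chiC z). Qed.

Lemma conj_chi z r : (chi z r)^*%C = chi (- z) r.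
Proof.
rewrite chiNl /chi rmorphXz ?unitfE ?theta1_neq0//.
by rewrite -[X in X ^ _]/((theta1 R q)^*%C) conj_theta1 exprz_inv invr_expz.
Qed.

Lemma norm_chi z r : `|chi z r| = 1.
Proof.
by apply/eqP; rewrite -sqrp_eq1// sqr_normc conj_chi -chiDl subrr chi0l.
Qed.

Lemma card_site : #|{: site q d}| = (q ^ d)%N.
Proof. by rewrite card_mx mul1n card_ord Zp_cast. Qed.

(** Orthogonality of characters: if z is nonzero at the coordinate k, the unit
    vector e at k has chi z e != 1, and the sum is invariant under
    multiplication by chi z e. *)
Lemma sum_chi z : \sum_(r : site q d) chi z r = if z == 0 then (q ^ d)%:R else 0.
Proof.
have [->|z0] := eqVneq z 0.
  by under eq_bigr do rewrite chi0l; rewrite sumr_const card_site.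
have [k zk] : exists k, z ord0 k != 0.
  apply/existsP; apply: contraNT z0 => /existsPn h; apply/eqP/rowP => k.
  by rewrite mxE; apply/eqP/negbNE/h.
pose e : site q d := \row_j (if j == k then 1 else 0).
have eE : chi z e = theta1 R q ^+ z ord0 k.
  rewrite chiE (bigD1 k)//= big1 => [|j jk].
    by rewrite mulr1 !mxE eqxx -exprM /= modn_small ?mul1n// Zp_cast.
  by rewrite mxE (negbTE jk) expr0 expr1n.
have e1 : chi z e != 1.
  rewrite eE -(expr0 (theta1 R q)) (eq_prim_root_expr theta1_prim).
  have zq : (z ord0 k < q)%N by rewrite -[X in (_ < X)%N]Zp_cast// ltn_ord.
  by rewrite !modn_small// ltnW.
(* translating the summation variable by e multiplies the sum by chi z e *)
have : chi z e * \sum_(r : site q d) chi z r = \sum_(r : site q d) chi z r.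
  rewrite mulr_sumr [RHS](reindex (fun r => e + r)) /=; last first.
    by exists (fun r => - e + r) => r _; rewrite ?addKr ?addNKr.
  by apply: eq_bigr => r _; rewrite chiDr.
move=> /eqP; rewrite -subr_eq0 -{2}(mul1r (\sum_r _)) -mulrBl mulf_eq0.
by rewrite subr_eq0 (negbTE e1) => /eqP.
Qed.
End characters.

(** * Linearity of the complex expectation *)

Section complex_expectation_linear.
Context d (T : measurableType d) (R : realType) (P : probability T R).

Lemma expectation_lincomb (I : finType) (a : I -> R) (f : I -> T -> R) :
  (forall i, P.-integrable [set: T] (EFin \o f i)) ->
  P.-integrable [set: T] (EFin \o (fun w => \sum_i a i * f i w)) /\
  fine 'E_P[fun w => \sum_i a i * f i w] = \sum_i a i * fine 'E_P[f i].
Proof.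
move=> intf.
have intaf i : P.-integrable [set: T] (fun w => ((a i)%:E * (f i w)%:E)%E).
  exact: integrableZl (intf i).
have E : EFin \o (fun w => \sum_i a i * f i w) =
    fun w => (\sum_i (a i)%:E * (f i w)%:E)%E.
  by apply/funext => w /=; rewrite -sumEFin; apply: eq_bigr => i _; rewrite EFinM.
split; first by rewrite E; exact: integrable_sum.
rewrite unlock [X in fine X](_ : _ =
    (\int[P]_w (\sum_i (a i)%:E * (f i w)%:E))%E); last first.
  by apply: eq_integral => w _; rewrite -(congr1 (@^~ w) E).
rewrite integral_sum//.
rewrite -EFin_sum_fine /=; last by move=> i _; apply: integrable_fin_num.
apply: eq_bigr => i _; rewrite integralZl//; last exact: intf.
rewrite fineM//; exact: integrable_fin_num (intf i).
Qed.

(** Every complex random variable below is a finite complex combination of real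
    ones (indicators of {V = v}, or Gaussians and their products), so this
    linearity is all that is needed of the complex expectation. *)
Lemma cexpectation_lincomb (I : finType) (c : I -> R[i]) (f : I -> T -> R) :
  (forall i, P.-integrable [set: T] (EFin \o f i)) ->
  cintegrable P (fun w => \sum_i c i * (f i w)%:C%C) /\
  cexpectation P (fun w => \sum_i c i * (f i w)%:C%C) =
    \sum_i c i * (fine 'E_P[f i])%:C%C.
Proof.
move=> intf.
have ReD : {morph @complex.Re R : x y / x + y} by case=> ? ? [].
have ImD : {morph @complex.Im R : x y / x + y} by case=> ? ? [].
have ReE (x : I -> R) : complex.Re (\sum_i c i * (x i)%:C%C) =
    \sum_i complex.Re (c i) * x i.
  rewrite (big_morph _ ReD erefl); apply: eq_bigr => i _.
  by case: (c i) => u v; simpc.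
have ImE (x : I -> R) : complex.Im (\sum_i c i * (x i)%:C%C) =
    \sum_i complex.Im (c i) * x i.
  rewrite (big_morph _ ImD erefl); apply: eq_bigr => i _.
  by case: (c i) => u v; simpc.
have [i1 e1] := expectation_lincomb (fun i => complex.Re (c i)) intf.
have [i2 e2] := expectation_lincomb (fun i => complex.Im (c i)) intf.
have RE : (fun w => complex.Re (\sum_i c i * (f i w)%:C%C)) =
    (fun w => \sum_i complex.Re (c i) * f i w) by apply/funext => w.
have IE : (fun w => complex.Im (\sum_i c i * (f i w)%:C%C)) =
    (fun w => \sum_i complex.Im (c i) * f i w) by apply/funext => w.
rewrite /cintegrable /cexpectation RE IE; split => //.
by apply/eqP; rewrite eq_complex /= ReE ImE e1 e2 !eqxx.
Qed.
End complex_expectation_linear.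

(** * Products of two independent variables *)

Section independent_pair.
Context d (T : measurableType d) (R : realType) (P : probability T R).

(** The joint law of an independent pair agrees with the product of the marginal
    laws on rectangles, hence everywhere. *)
Lemma independent2_Fubini d1 d2 (T1 : measurableType d1)
    (T2 : measurableType d2) (X : {RV P >-> T1}) (Y : {RV P >-> T2})
    (h : T1 * T2 -> \bar R) :
  (forall A B, measurable A -> measurable B ->
    P (X @^-1` A `&` Y @^-1` B) = (P (X @^-1` A) * P (Y @^-1` B))%E) ->
  measurable_fun setT h ->
  P.-integrable [set: T] (fun w => h (X w, Y w)) ->
  (\int[P]_w h (X w, Y w) =
   \int[distribution P X]_x \int[distribution P Y]_y h (x, y))%E.
Proof.
move=> indep mh ih.
have mW : measurable_fun [set: T] (fun w => (X w, Y w)).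
  exact: measurable_fun_pair.
pose WB := isMeasurableFun.Build _ _ _ _ _ mW.
pose W : {RV P >-> (T1 * T2)%type} := HB.pack (fun w => (X w, Y w)) WB.
have lawE A : measurable A -> A `<=` [set: T1 * T2] ->
    (distribution P X \x distribution P Y)%E A = distribution P W A.
  move=> mA _.
  by apply: (@product_measure_unique _ _ _ _ _ (distribution P X)
    (distribution P Y) (distribution P W)) => // B C mB mC; exact: indep.
rewrite integral12_prod_meas1.
  by rewrite (eq_measure_integral _ lawE) integral_distribution.
apply/integrableP; split => //.
rewrite (eq_measure_integral _ lawE) ge0_integral_distribution//.
  by have /integrableP[] := ih.
exact: measurableT_comp.
Qed.

Lemma independent2_integralM (X Y : {RV P >-> R}) :
  (forall A B, measurable A -> measurable B ->
    P (X @^-1` A `&` Y @^-1` B) = (P (X @^-1` A) * P (Y @^-1` B))%E) ->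
  P.-integrable [set: T] (EFin \o X) ->
  P.-integrable [set: T] (EFin \o Y) ->
  P.-integrable [set: T] (fun w => (X w * Y w)%:E) ->
  (\int[P]_w (X w * Y w)%:E =
   (\int[P]_w (X w)%:E) * (\int[P]_w (Y w)%:E))%E.
Proof.
move=> indep iX iY iXY.
rewrite (independent2_Fubini (h := fun z : R * R => (z.1 * z.2)%:E) indep)//;
  last first.
  by apply/measurable_EFinP; apply: measurable_funM.
have mEFin : measurable_fun [set: R] (@EFin R) by apply/measurable_EFinP.
transitivity (\int[distribution P X]_x (x%:E * \int[P]_w (Y w)%:E))%E.
  apply: eq_integral => x _ /=.
  rewrite -(integral_distribution mEFin iY) -integralZl//.
  exact: integrable_pushforward.
rewrite -[X in (_ * X)%E]fineK ?integrable_fin_num//.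
under eq_integral do rewrite -[X in (_ * X)%E]fineK ?integrable_fin_num//.
rewrite integralZr//; last exact: integrable_pushforward.
by rewrite integral_distribution.
Qed.
End independent_pair.

(** * Moments of the standard Gaussian *)

Section gaussian_moments.
Context (R : realType).
Local Notation mu := (@lebesgue_measure R).
Local Notation phi := (@normal_pdf R 0 1).

(** The density is a Radon-Nikodym derivative, unique up to null sets. *)
Lemma ge0_integral_normal_prob (f : R -> \bar R) :
  measurable_fun [set: R] f -> (forall x, 0 <= f x)%E ->
  (\int[normal_prob 0 1]_x f x = \int[mu]_x (f x * (phi x)%:E))%E.
Proof.
move=> mf f0.
have dom := @normal_prob_dominates R 0 1.
rewrite -(Radon_Nikodym_SigmaFinite.change_of_variables dom f0 measurableT mf).
have mphi : measurable_fun [set: R] (fun x => (phi x)%:E).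
  by apply/measurable_EFinP; exact: measurable_normal_pdf.
have iRN := Radon_Nikodym_SigmaFinite.f_integrable dom.
apply: ae_eq_integral => //.
- by apply: emeasurable_funM => //; exact: measurable_int iRN.
- exact: emeasurable_funM.
- apply: ae_eqe_mul2l.
  apply: integral_ae_eq => // E _ mE.
  by rewrite -Radon_Nikodym_SigmaFinite.f_integral.
Qed.

(** Folding the negative half-line onto the positive one makes symmetry under
    x |-> -x visible, the order of the two summands being irrelevant. *)
Lemma ge0_integralT_fold (G : R -> R) : (forall x, 0 <= G x) ->
  continuous G ->
  (\int[mu]_x (G x)%:E = \int[mu]_(x in `[0%R, +oo[) (G x)%:E +
                         \int[mu]_(x in `[0%R, +oo[) (G (- x)%R)%:E)%E.
Proof.
move=> G0 cG.
have mG : measurable_fun [set: R] G by exact: continuous_measurable_fun.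
have mEG : measurable_fun [set: R] (fun x => (G x)%:E) by exact/measurable_EFinP.
rewrite -(setUv `[0, +oo[%classic) ge0_integral_setU//=; last 4 first.
- exact: measurableC.
- by rewrite setUv.
- by move=> x _; rewrite lee_fin.
- exact/disj_setPCl.
congr (_ + _)%E; rewrite setCitvr.
rewrite integral_itv_bndo_bndc; last exact: measurable_funTS.
rewrite -{1}oppr0 ge0_integration_by_substitutionNy//.
exact: continuous_subspaceT.
Qed.

Lemma ge0_integralT_opp (G : R -> R) : (forall x, 0 <= G x) ->
  continuous G -> (\int[mu]_x (G (- x)%R)%:E = \int[mu]_x (G x)%:E)%E.
Proof.
move=> G0 cG; rewrite (ge0_integralT_fold G0 cG).
rewrite (@ge0_integralT_fold (G \o -%R)) => [|x|]; [|exact: G0|]; last first.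
  by move=> x; apply: continuous_comp; [exact: opp_continuous|exact: cG].
by rewrite addeC; congr (_ + _)%E; apply: eq_integral => x _ /=; rewrite opprK.
Qed.

Lemma normal_pdf01E x : phi x = normal_peak 1 * expR (- x ^+ 2 / 2).
Proof. by rewrite normal_pdfE ?oner_eq0// /normal_fun subr0 expr1n. Qed.

Lemma normal_pdf0N x : phi (- x) = phi x.
Proof. by rewrite !normal_pdf01E sqrrN. Qed.

Lemma is_derive_normal_pdf (x : R) : is_derive x 1 phi (- x * phi x).
Proof.
have -> : phi = fun x => normal_peak 1 * expR (- x ^+ 2 / 2) :> R.
  by apply/funext => y; rewrite normal_pdf01E.
have d2 : is_derive x 1 (fun x : R => - x ^+ 2 / 2) (- x).
  apply: is_derive_eq; rewrite /GRing.scale /=; lra.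
have := @is_derive1_comp R expR (fun x => - x ^+ 2 / 2) x _ _
  (is_derive_expR (- x ^+ 2 / 2)) d2.
move=> /(is_deriveZ (normal_peak 1)).
set a := (X in is_derive _ _ X _ -> _); set b := (X in is_derive _ _ _ X -> _).
rewrite (_ : b = - x * (normal_peak 1 * expR (- x ^+ 2 / 2)))//.
by rewrite /b /GRing.scale /=; ring.
Qed.

(** Integration by parts, with (phi x)' = - x phi x. *)
Lemma second_moment_segment (n : nat) :
  (\int[mu]_(x in `[0%R, n%:R]) (x ^+ 2 * phi x)%:E =
   \int[mu]_(x in `[0%R, n%:R]) (phi x)%:E - (n%:R * phi n%:R)%:E)%E.
Proof.
have cphi := @continuous_normal_pdf R 0 1 (oner_neq0 _).
have [->|n0] := eqVneq n 0%N.
  by rewrite mul0r sube0 !set_itv1 !integral_set1.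
have n_gt0 : 0 < n%:R :> R by rewrite ltr0n lt0n.
transitivity (\int[mu]_(x in `[0%R, n%:R]) (- x * (- x * phi x))%:E)%E.
  by apply: eq_integral => x _; rewrite mulrA mulrNN.
rewrite (@integration_by_parts R -%R phi (cst (-1)) (fun x => - x * phi x))//.
- rewrite oppr0 mul0r subr0.
  under [in LHS]eq_integral do rewrite EFinM.
  rewrite integralZl//; last first.
    apply: (integrableS measurableT) => //; exact: integrable_normal_pdf.
  by rewrite EFinN mulN1e oppeK addeC mulNr EFinN.
- by move=> x; apply: cvg_cst.
- split.
  + by move=> x _; exact: derivableN.
  + by apply: cvg_at_right_filter; exact: opp_continuous.
  + by apply: cvg_at_left_filter; exact: opp_continuous.
- by move=> x _; rewrite derive1E derive_val.
- apply: continuous_subspaceT => x.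
  by apply: continuousM; [exact: opp_continuous|exact: cphi].
- split.
  + by move=> x _; have [] := is_derive_normal_pdf x.
  + by apply: cvg_at_right_filter; exact: cphi.
  + by apply: cvg_at_left_filter; exact: cphi.
- by move=> x _; rewrite derive1E; have [_ ->] := is_derive_normal_pdf x.
Qed.

(** From exp (n^2 / 2) >= 1 + n^2 / 2 and n (n + 1) <= 4 (1 + n^2 / 2). *)
Lemma cvg_boundary_term : (n%:R * phi n%:R : R) @[n --> \oo] --> (0 : R).
Proof.
have c0 := @normal_peak_ge0 R 1.
apply: (@squeeze_cvgr _ _ _ _ (cst 0) (fun n => 4 * normal_peak 1 * harmonic n)).
- apply: nearW => n /=; rewrite mulr_ge0 ?normal_pdf_ge0//=.
  rewrite normal_pdf01E mulrCA -!mulrA [leRHS]mulrCA ler_wpM2l//.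
  have e0 : 0 < 1 + n%:R ^+ 2 / 2 :> R by rewrite ltr_pwDl// divr_ge0 ?sqr_ge0.
  apply: (@le_trans _ _ (n%:R * (1 + n%:R ^+ 2 / 2)^-1)).
    by rewrite ler_wpM2l// mulNr expRN lef_pV2 ?posrE ?expR_gt0// expR_ge1Dx.
  rewrite ler_pdivrMr// mulrAC ler_pdivlMr ?ltr0n// -natr1.
  nra.
- exact: cvg_cst.
- rewrite -[X in _ --> X](mulr0 (4 * normal_peak 1)).
  by apply: cvgM; [exact: cvg_cst|exact: cvg_harmonic].
Qed.

(** On [0, +oo[ the second moment equals the mass, the boundary term of the
    integration by parts vanishing at infinity; evenness doubles both sides. *)
Lemma integral_sqr_normal_pdf : (\int[mu]_x (x ^+ 2 * phi x)%:E = 1)%E.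
Proof.
have cphi := @continuous_normal_pdf R 0 1 (oner_neq0 _).
have phi0 := @normal_pdf_ge0 R 0 1.
have f0 x : 0 <= x ^+ 2 * phi x by rewrite mulr_ge0 ?sqr_ge0.
have cf : continuous (fun x : R => x ^+ 2 * phi x).
  by move=> x; apply: cvgM; [exact: sqr_continuous|exact: cphi].
suff half : (\int[mu]_(x in `[0%R, +oo[) (x ^+ 2 * phi x)%:E =
             \int[mu]_(x in `[0%R, +oo[) (phi x)%:E)%E.
  rewrite -(integral_normal_pdf 0 1) (ge0_integralT_fold f0 cf).
  rewrite (ge0_integralT_fold phi0 cphi) half; congr (_ + _)%E.
  under eq_integral do rewrite sqrrN normal_pdf0N.
  by rewrite half; apply: eq_integral => x _; rewrite normal_pdf0N.
have mf := continuous_measurable_fun cf.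
have mphi := continuous_measurable_fun cphi.
have cvl := @ge0_cvgn_integral R mu _ f0 mf.
have cvr := @ge0_cvgn_integral R mu _ phi0 mphi.
have cvl2 : (\int[mu]_(x in `[0%R, n%:R]) (x ^+ 2 * phi x)%:E @[n --> \oo] -->
    \int[mu]_(x in `[0%R, +oo[) (phi x)%:E)%E.
  under eq_fun do rewrite second_moment_segment.
  rewrite -[X in nbhs X]sube0; apply: cvgeB => //.
    by rewrite fin_num_adde_defl.
  apply: cvg_EFin; first exact: nearW.
  exact: cvg_boundary_term.
exact: (cvg_unique _ cvl cvl2).
Qed.
End gaussian_moments.

Section standard_gaussian.
Context (R : realType) d (T : measurableType d) (P : probability T R).

Section one_variable.
Variable g : {RV P >-> R}.
Hypothesis g_law :
  forall A, measurable A -> distribution P g A = normal_prob 0 1 A.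

Lemma ge0_integral_gaussian (f : R -> \bar R) :
  measurable_fun [set: R] f -> (forall x, 0 <= f x)%E ->
  (\int[P]_w f (g w) =
   \int[lebesgue_measure]_x (f x * (normal_pdf 0 1 x)%:E))%E.
Proof.
move=> mf f0; rewrite -ge0_integral_normal_prob//.
(* The normal law lives on the Borel copy of R generated by intervals: g is
   read as a variable with values there. *)
have mg : measurable_fun [set: T] (g : T -> measurableTypeR R).
  exact: (@measurable_funPT _ _ _ _ g).
pose gB := isMeasurableFun.Build _ _ _ _ _ mg.
pose g' : {RV P >-> measurableTypeR R} := HB.pack (g : T -> measurableTypeR R) gB.
rewrite -[LHS](ge0_integral_distribution g' mf f0).
by apply: eq_measure_integral => A mA _; exact: g_law.
Qed.

Lemma integral_gaussian_sqr : (\int[P]_w (g w ^+ 2)%:E = 1)%E.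
Proof.
rewrite (ge0_integral_gaussian (f := fun x => (x ^+ 2)%:E)).
- by under eq_integral do rewrite -EFinM; exact: integral_sqr_normal_pdf.
- by apply/measurable_EFinP; exact: measurable_funX.
- by move=> x; rewrite lee_fin sqr_ge0.
Qed.

Lemma integrable_gaussian_sqr :
  P.-integrable [set: T] (fun w => (g w ^+ 2)%:E).
Proof.
apply/integrableP; split.
  by apply/measurable_EFinP; exact: measurable_funX.
under eq_integral do rewrite gee0_abs ?lee_fin ?sqr_ge0//.
by rewrite integral_gaussian_sqr ltry.
Qed.

Lemma integrable_gaussian : P.-integrable [set: T] (EFin \o g).
Proof.
apply: (@le_integrable _ _ _ P setT measurableT _
  (fun w => (1 + g w ^+ 2)%:E)) => //.
- exact/measurable_EFinP.
- move=> w _ /=; rewrite lee_fin [leRHS]ger0_norm ?addr_ge0 ?sqr_ge0//.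
  rewrite -[g w ^+ 2]real_normK ?num_real//.
  by have := sqr_ge0 (`|g w| - 1); nra.
- apply: (@integrableD _ _ _ P setT measurableT (fun=> 1%:E)
    (fun w => (g w ^+ 2)%:E)); last exact: integrable_gaussian_sqr.
  exact: finite_measure_integrable_cst.
Qed.

(** The positive and the negative parts of g have the same mean, exchanged by
    x |-> -x. *)
Lemma integral_gaussian : (\int[P]_w (g w)%:E = 0)%E.
Proof.
(* s = 1 gives the positive part, s = -1 the negative one. *)
have part s : (\int[P]_w (Num.max (s * g w) 0)%:E =
    \int[lebesgue_measure]_x (Num.max (s * x) 0 * normal_pdf 0 1 x)%:E)%E.
  rewrite (ge0_integral_gaussian (f := fun x => (Num.max (s * x) 0)%:E)).
  - by apply: eq_integral => x _; rewrite EFinM.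
  - by apply/measurable_EFinP; exact: measurable_maxr.
  - by move=> x; rewrite lee_fin le_max lexx orbT.
have iG : P.-integrable [set: T] (EFin \o g) := integrable_gaussian.
have posE : (\int[P]_w ((EFin \o g)^\+ w) =
             \int[P]_w (Num.max (1 * g w) 0)%:E)%E.
  by apply: eq_integral => w _; rewrite funeposE mul1r EFin_max.
have negE : (\int[P]_w ((EFin \o g)^\- w) =
             \int[P]_w (Num.max (- 1 * g w) 0)%:E)%E.
  by apply: eq_integral => w _; rewrite funenegE mulN1r EFin_max.
have fin := integrable_pos_fin_num measurableT iG.
rewrite -[LHS]/(\int[P]_w ((EFin \o g) w))%E integralE.
suff -> : (\int[P]_w ((EFin \o g)^\- w) = \int[P]_w ((EFin \o g)^\+ w))%E.
  by rewrite subee.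
rewrite posE negE !part -[RHS]ge0_integralT_opp.
- by apply: eq_integral => x _; rewrite mulN1r mul1r normal_pdf0N.
- by move=> x; rewrite mulr_ge0 ?normal_pdf_ge0// le_max lexx orbT.
- move=> x; apply: cvgM; last by apply: continuous_normal_pdf; exact: oner_neq0.
  apply: continuous_max; last exact: cvg_cst.
  by apply: cvgM; [exact: cvg_cst|exact: cvg_id].
Qed.
End one_variable.

(** Integrability of the product follows from 2 |a b| <= a^2 + b^2, whether or
    not r and s are distinct. *)
Lemma integral_iid_gaussianM (I : eqType) (gamma : I -> {RV P >-> R}) r s :
  iid_standard_gaussian gamma ->
  P.-integrable [set: T] (fun w => (gamma r w * gamma s w)%:E) /\
  (\int[P]_w (gamma r w * gamma s w)%:E = ((r == s)%:R)%:E)%E.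
Proof.
move=> [indep law].
have irs : P.-integrable [set: T] (fun w => (gamma r w * gamma s w)%:E).
  apply: (@le_integrable _ _ _ P setT measurableT _
    (fun w => (gamma r w ^+ 2 + gamma s w ^+ 2)%:E)) => //.
  - by apply/measurable_EFinP; exact: measurable_funM.
  - move=> w _ /=; rewrite lee_fin [leRHS]ger0_norm ?addr_ge0 ?sqr_ge0//.
    rewrite normrM -[gamma r w ^+ 2]real_normK ?num_real//.
    rewrite -[gamma s w ^+ 2]real_normK ?num_real//.
    by have := sqr_ge0 (`|gamma r w| - `|gamma s w|);
      have := sqr_ge0 (`|gamma r w| + `|gamma s w|); nra.
  - apply: (@integrableD _ _ _ P setT measurableT
      (fun w => (gamma r w ^+ 2)%:E) (fun w => (gamma s w ^+ 2)%:E));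
      by apply: integrable_gaussian_sqr; apply: law.
split => //; have [<-|rs] := eqVneq r s.
  by rewrite -(integral_gaussian_sqr (law r)).
rewrite independent2_integralM//.
- by rewrite integral_gaussian ?mul0e//; exact: law.
- move=> A B mA mB.
  have := indep [:: r; s] (fun j => if j == r then A else B).
  rewrite /= inE rs /= => /(_ isT) /(_ _).
  rewrite big_cons big_seq1 eqxx eq_sym (negbTE rs) => <-; last by move=> j; case: ifP.
  congr (P _); apply/seteqP; split=> w /=.
    move=> [Aw Bw] j /=; rewrite !inE => /orP[]/eqP->; rewrite ?eqxx//.
    by rewrite eq_sym (negbTE rs).
  move=> h; split.
    by have := h r; rewrite /= !inE eqxx => /(_ isT).
  by have := h s; rewrite /= !inE eqxx orbT eq_sym (negbTE rs) => /(_ isT).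
- exact: integrable_gaussian (law r).
- exact: integrable_gaussian (law s).
Qed.
End standard_gaussian.

(** * The law of the walk *)

Section random_walk_law.
Context (R : realType) (q n : nat).
Hypothesis q_gt1 : (2 <= q)%N.

Lemma fine_partition d (T : measurableType d) (P : probability T R)
    (W : {RV P >-> site q n}) (E : set T) : measurable E ->
  fine (P E) = \sum_(v : site q n) fine (P (E `&` W @^-1` [set v])).
Proof.
move=> mE.
have mF v : measurable (E `&` W @^-1` [set v]).
  by apply: measurableI => //; exact: measurable_funPTI.
have EE : E = \bigcup_(v in [set` index_enum (site q n)]) (E `&` W @^-1` [set v]).
  by apply/seteqP; split => [w Ew|w [v _ []]//]; exists (W w);
    rewrite /= ?mem_index_enum.
have -> : P E = (\sum_(v : site q n) P (E `&` W @^-1` [set v]))%E.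
  rewrite [in LHS]EE measure_fin_bigcup//=.
  - by rewrite -fsbig_seq// index_enum_uniq.
  - apply/trivIsetP => u v _ _ uv; apply/seteqP; split=> // w [[_ /= Wu] [_ /= Wv]].
    by move/eqP: uv; apply; rewrite -Wu -Wv.
rewrite -EFin_sum_fine//= => v _; exact: fin_num_measure.
Qed.

Lemma rho_lincomb d (T : measurableType d) (P : probability T R)
    (V : {RV P >-> site q n}) r :
  rho V r = \sum_(v : site q n)
    chi R v r * (fine (P (V @^-1` [set v])))%:C%C.
Proof.
have mV v : measurable (V @^-1` [set v]) by exact: measurable_funPTI.
have iV v : P.-integrable [set: T] (EFin \o \1_(V @^-1` [set v])).
  exact: integrable_indic.
have [_] := cexpectation_lincomb (fun v => chi R v r) iV.
under eq_bigr do rewrite expectation_indic//.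
move=> <-; congr cexpectation; apply/funext => w.
rewrite (bigD1 (V w))//= indicE mem_set// mulr1 big1 ?addr0// => v vw.
by rewrite indicE memNset ?mulr0// => /= wv; move: vw; rewrite wv eqxx.
Qed.

Context d0 (T0 : measurableType d0) (P0 : probability T0 R).
Variable V : {RV P0 >-> site q n}.
Context d1 (T1 : measurableType d1) (P1 : probability T1 R).
Variables X Z : nat -> {RV P1 >-> site q n}.
Hypothesis walkX : random_walk V X Z.

Definition cylinder (J : seq nat) (A : nat -> set (site q n)) : set T1 :=
  \bigcap_(j in [set` J]) (Z j @^-1` A j).

Lemma measurable_cylinder J A : measurable (cylinder J A).
Proof.
apply: fin_bigcap_measurable => [|j _]; first exact: finite_seq.
exact: measurable_funPTI.
Qed.

(** X_0 is independent of the sigma-algebra generated by all the Z_i; this puts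
    cylinders within reach of that hypothesis. *)
Lemma g_sigma_algebra_cylinder J A :
  g_sigma_algebra_family Z (cylinder J A).
Proof.
pose G := \bigcup_(i in [set: nat]) g_sigma_algebra_preimage (Z i).
apply: (@fin_bigcap_measurable _ (g_sigma_algebraType G)) => [|j _].
  exact: finite_seq.
apply: sub_sigma_algebra; exists j => //.
by exists (A j) => //; rewrite setTI.
Qed.

Lemma cylinder_cons J A s v : s \notin J ->
  cylinder (s :: J) (fun j => if j == s then [set v] else A j) =
  Z s @^-1` [set v] `&` cylinder J A.
Proof.
move=> sJ; apply/seteqP; split=> w.
  move=> h; split; first by have := h s; rewrite /= inE eqxx; exact.
  move=> j jJ; have := h j; rewrite /= inE (jJ : j \in J) orbT ifN; first exact.
  by apply: contraNneq sJ => <-.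
move=> [Zs h] j; rewrite /= inE; case: eqVneq => [-> //|_ /= jJ]; exact: h.
Qed.

Lemma prob_cylinder_cons J A s v : uniq J -> s \notin J ->
  P1 (Z s @^-1` [set v] `&` cylinder J A) =
  (P1 (Z s @^-1` [set v]) * P1 (cylinder J A))%E.
Proof.
move=> uJ sJ; rewrite -cylinder_cons// /cylinder (walk_indep walkX)//= ?sJ//.
rewrite big_cons eqxx (walk_indep walkX)//; congr (_ * _)%E.
rewrite big_seq [RHS]big_seq; apply: eq_bigr => j jJ; rewrite ifN//.
by apply: contraNneq sJ => <-.
Qed.

(** The future cylinder makes the induction on s go through: splitting the event
    at time s + 1 along the value v of Z_s turns it into events at time s with
    the cylinder enlarged by {Z_s = v}, so that independence is only ever used
    between X_0 and a cylinder, and between the factors of a cylinder.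
    The Fourier factor is the s-fold convolution power of the law of V at u - x:
    at s = 0 it is the orthogonality relation, and summing
    P(V = v) chi (x - u + v) r over v multiplies the r-th term by rho_r. *)
Lemma walk_cylinder s x u J A : uniq J -> (forall j, j \in J -> (s <= j)%N) ->
  (fine (P1 (X 0%N @^-1` [set x] `&` X s @^-1` [set u] `&` cylinder J A)))%:C%C =
  (fine (P1 (X 0%N @^-1` [set x])))%:C%C * (fine (P1 (cylinder J A)))%:C%C *
  (((q ^ n)%:R)^-1 * \sum_(r : site q n) rho V r ^+ s * chi R (x - u) r).
Proof.
elim: s u J A => [|s IH] u J A uJ geJ.
  under eq_bigr do rewrite expr0 mul1r.
  rewrite sum_chi// subr_eq0; have [<-|xu] := eqVneq x u.
    rewrite setIid (walk_indep0 walkX)//; last exact: g_sigma_algebra_cylinder.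
    rewrite fineM ?fin_num_measure//; last 2 first.
    - exact: measurable_funPTI.
    - exact: measurable_cylinder.
    rewrite mulVf ?mulr1 ?rmorphM// pnatr_eq0 expn_eq0 negb_and -lt0n.
    by rewrite (ltnW q_gt1).
  rewrite mulr0 (_ : _ `&` _ = set0) ?measure0 ?mulr0//.
  by apply/seteqP; split => // w [[/= -> /eqP]]; rewrite (negbTE xu).
have sJ : s \notin J by apply/negP => /geJ; rewrite ltnn.
rewrite (fine_partition (Z s)); last first.
  apply: measurableI; last exact: measurable_cylinder.
  by apply: measurableI; exact: measurable_funPTI.
rewrite rmorph_sum /=.
have step v : X 0%N @^-1` [set x] `&` X s.+1 @^-1` [set u] `&` cylinder J A
      `&` Z s @^-1` [set v] =
    X 0%N @^-1` [set x] `&` X s @^-1` [set u - v] `&`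
      cylinder (s :: J) (fun j => if j == s then [set v] else A j).
  rewrite cylinder_cons//; apply/seteqP; split=> w /=.
    move=> [[[-> Xu] cw] Zv]; split=> //; split=> //.
    by rewrite -Xu (walk_step walkX) -Zv addrK.
  move=> [[-> Xu] [Zv cw]]; split=> //; split=> //; split=> //.
  by rewrite (walk_step walkX) Xu Zv subrK.
have lawZ v : P1 (Z s @^-1` [set v]) = P0 (V @^-1` [set v]).
  exact: (walk_distr walkX s (A := [set v])).
transitivity (\sum_(v : site q n)
    (fine (P1 (X 0%N @^-1` [set x])))%:C%C * (fine (P1 (cylinder J A)))%:C%C *
    (((q ^ n)%:R)^-1 * \sum_(r : site q n) rho V r ^+ s *
      (chi R v r * (fine (P0 (V @^-1` [set v])))%:C%C) * chi R (x - u) r)).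
  apply: eq_bigr => v _; rewrite step IH /= ?sJ//; last first.
    by move=> j; rewrite inE => /predU1P[->//|/geJ /ltnW].
  rewrite cylinder_cons// prob_cylinder_cons// fineM ?fin_num_measure//; last 2 first.
  - exact: measurable_funPTI.
  - exact: measurable_cylinder.
  rewrite lawZ rmorphM /= -!mulrA; congr (_ * _).
  rewrite mulrCA; congr (_ * _); rewrite mulrCA; congr (_ * _).
  rewrite mulr_sumr; apply: eq_bigr => r _.
  by rewrite opprB addrA addrAC [chi R (x - u + v) r]chiDl//; ring.
rewrite -!mulr_sumr; do 2 congr (_ * _).
rewrite exchange_big; apply: eq_bigr => r _ /=.
by rewrite exprSr rho_lincomb mulr_sumr mulr_suml.
Qed.
End random_walk_law.

(** * The Green function *)

Section green_function.
Context (R : realType) (q n : nat).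
Hypothesis q_gt1 : (2 <= q)%N.
Context d0 (T0 : measurableType d0) (P0 : probability T0 R).
Variable V : {RV P0 >-> site q n}.

Lemma norm_rho_le1 r : `|rho V r| <= 1.
Proof.
rewrite rho_lincomb// (le_trans (ler_norm_sum _ _ _))//.
have -> : 1 = \sum_(v : site q n) (fine (P0 (V @^-1` [set v])))%:C%C :> R[i].
  rewrite -rmorph_sum /= -(rmorph1 (real_complex R)) /=; congr (_%:C%C).
  have := fine_partition V measurableT.
  by rewrite probability_setT /= => ->; apply: eq_bigr => v _; rewrite setTI.
apply: ler_sum => v _; rewrite normrM norm_chi// mul1r ger0_norm//.
by rewrite ler0c fine_ge0.
Qed.

Lemma cvg_fourier_series (I : finType) (c a : I -> R) (alpha : R) :
  0 < alpha < 1 -> (forall r, `|a r| <= 1) ->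
  series (fun t => alpha ^+ t * \sum_r c r * a r ^+ t) @ \oo -->
    \sum_r c r / (1 - alpha * a r).
Proof.
move=> /andP[alpha0 alpha1] a1.
have -> : series (fun t => alpha ^+ t * \sum_r c r * a r ^+ t) =
    fun N => \sum_r series (geometric (c r) (alpha * a r)) N.
  apply/funext => N; rewrite /series /= exchange_big; apply: eq_bigr => t _ /=.
  by rewrite mulr_sumr; apply: eq_bigr => r _; rewrite exprMn mulrCA.
apply: cvg_big => [|r _]; first exact: add_continuous.
apply: cvg_geometric_series.
rewrite normrM gtr0_norm// (le_lt_trans _ alpha1)//.
by rewrite ler_piMr// ltW.
Qed.

Lemma weight_real (alpha a : R) : 0 < alpha < 1 ->
  weight alpha a%:C%C = ((1 - alpha * a) / (1 - alpha))%:C%C.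
Proof.
move=> /andP[_ alpha1]; have a10 : 1 - alpha != 0 by rewrite subr_eq0 gt_eqF.
rewrite /weight -(rmorph1 (real_complex R)) /= -rmorphB -rmorphM -rmorphD /=.
by congr (_%:C%C); field.
Qed.

Context d1 (T1 : measurableType d1) (P1 : probability T1 R).
Variables X Z : nat -> {RV P1 >-> site q n}.
Hypothesis walkX : random_walk V X Z.

Lemma transition_prob x y t : (0 < P1 (X 0%N @^-1` [set x]))%E ->
  (cond_prob P1 (X t @^-1` [set y]) (X 0%N @^-1` [set x]))%:C%C =
  ((q ^ n)%:R)^-1 * \sum_(r : site q n) rho V r ^+ t * chi R (x - y) r.
Proof.
move=> Px; have Px0 : fine (P1 (X 0%N @^-1` [set x])) != 0.
  rewrite gt_eqF// fine_gt0// Px /= ltey_eq fin_num_measure//.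
  exact: measurable_funPTI.
have := walk_cylinder q_gt1 walkX x y (J := [::]) (s := t) (fun=> set0) isT.
have -> : cylinder Z [::] (fun=> set0) = setT.
  by rewrite /cylinder set_nil bigcap_set0.
rewrite setIT probability_setT /= mulr1 => E.
rewrite /cond_prob setIC rmorphM /= fmorphV E //.
by rewrite mulrAC mulfV ?mul1r// (inj_eq (@complexI R)).
Qed.

(** The limit defining the Green function is taken in the real numbers, whereas
    the Fourier formula is complex: real and imaginary parts of the sum over r
    are treated separately. *)
Lemma Green_fourier (alpha : R) (x y : site q n) :
  0 < alpha < 1 -> (forall r, rho V r \is Num.real) ->
  (0 < P1 (X 0%N @^-1` [set x]))%E ->
  ((1 - alpha) * Green X alpha x y)%:C%C =
  ((q ^ n)%:R)^-1 * \sum_(r : site q n)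
    (weight alpha (rho V r))^-1 * chi R (x - y) r.
Proof.
move=> alpha01 rho_real Px.
pose a r := complex.Re (rho V r).
have rhoE r : rho V r = (a r)%:C%C by rewrite RRe_real.
have a1 r : `|a r| <= 1.
  rewrite -lecR (_ : 1%:C%C = 1)//; apply: le_trans (norm_rho_le1 r).
  exact: normc_ge_Re.
pose N : R := ((q ^ n)%:R)^-1.
pose c r := complex.Re (chi R (x - y) r).
pose s r := complex.Im (chi R (x - y) r).
have chiE r : chi R (x - y) r = Complex (c r) (s r) by rewrite /c /s; case: chi.
have NE : ((q ^ n)%:R)^-1 = N%:C%C :> R[i] by rewrite fmorphV rmorph_nat.
have split_sum (b : site q n -> R) :
    ((q ^ n)%:R)^-1 * \sum_(r : site q n) (b r)%:C%C * chi R (x - y) r =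
    Complex (\sum_r N * c r * b r) (\sum_r N * s r * b r).
  rewrite NE mulr_sumr [RHS]complexE rmorph_sum (rmorph_sum (real_complex R)).
  rewrite mulr_sumr -big_split; apply: eq_bigr => r _ /=.
  rewrite chiE; simpc; congr Complex; ring.
have probE t : cond_prob P1 (X t @^-1` [set y]) (X 0%N @^-1` [set x]) =
      \sum_r N * c r * a r ^+ t /\ 0 = \sum_r N * s r * a r ^+ t.
  have := transition_prob y t Px.
  under eq_bigr do rewrite rhoE -rmorphXn.
  by rewrite split_sum => -[].
have GreenE : Green X alpha x y = \sum_r N * c r / (1 - alpha * a r).
  apply/cvg_lim => //; under eq_fun do rewrite (probE _).1.
  exact: cvg_fourier_series.
(* each transition probability being real, so is the sum of their series *)
have ImE : \sum_r N * s r / (1 - alpha * a r) = 0.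
  have cvI := @cvg_fourier_series _ (fun r => N * s r) a _ alpha01 a1.
  suff cv0 : series (fun t => alpha ^+ t * \sum_r N * s r * a r ^+ t) @ \oo -->
      (0 : R) by exact: (cvg_unique _ cvI cv0).
  rewrite (_ : series _ = cst 0); first exact: cvg_cst.
  apply/funext => k; rewrite /series /= big1// => t _.
  by rewrite -(probE t).2 mulr0.
have alpha1 : 1 - alpha != 0 by rewrite subr_eq0 gt_eqF//; case/andP: alpha01.
under eq_bigr do rewrite rhoE weight_real// -fmorphV invf_div.
rewrite split_sum GreenE mulr_sumr; congr Complex.
  by apply: eq_bigr => r _; rewrite mulrCA.
rewrite -[LHS](mulr0 (1 - alpha)) -[in LHS]ImE mulr_sumr.
by apply: eq_bigr => r _; rewrite mulrCA.
Qed.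
End green_function.

(** * The covariance of the field *)

Section covariance.
Context (R : realType) (q n : nat).
Hypothesis q_gt1 : (2 <= q)%N.

Lemma conjc_ge0 (z : R[i]) : 0 <= z -> z^*%C = z.
Proof. by case: z => a b /ger0_Im /= ->; rewrite oppr0. Qed.

Lemma weight_ge0 (alpha : R) (z : R[i]) : 0 < alpha < 1 ->
  z \is Num.real -> `|z| <= 1 -> 0 <= weight alpha z.
Proof.
move=> /andP[alpha0 alpha1] z_real z1.
rewrite addr_ge0// mulr_ge0//.
  by rewrite ler0c divr_ge0 ?subr_ge0// ltW.
by rewrite subr_ge0 (le_trans (real_ler_norm z_real)).
Qed.

Context d (T : measurableType d) (P : probability T R).
Variable gamma : site q n -> {RV P >-> R}.
Hypothesis gammaP : iid_standard_gaussian gamma.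

Lemma gaussian_lincomb_mean (c : site q n -> R[i]) :
  let g w := \sum_r c r * (gamma r w)%:C%C in
  cintegrable P g /\ cexpectation P g = 0.
Proof.
have [_ law] := gammaP; move=> g.
have [ig E] := cexpectation_lincomb c (fun r => integrable_gaussian (law r)).
split => //; rewrite [LHS]E big1// => r _.
by rewrite expectation_def integral_gaussian ?mulr0//; exact: law.
Qed.

Lemma gaussian_lincomb_covariance (a b : site q n -> R[i]) :
  let g w := (\sum_r a r * (gamma r w)%:C%C) *
             (\sum_r b r * (gamma r w)%:C%C)^*%C in
  cintegrable P g /\ cexpectation P g = \sum_r a r * (b r)^*%C.
Proof.
move=> g.
have int_rs (rs : site q n * site q n) :
    P.-integrable [set: T] (EFin \o (fun w => gamma rs.1 w * gamma rs.2 w)).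
  by have [] := integral_iid_gaussianM rs.1 rs.2 gammaP.
have gE : g = fun w => \sum_(rs : site q n * site q n)
    (a rs.1 * (b rs.2)^*%C) * (gamma rs.1 w * gamma rs.2 w)%:C%C.
  apply/funext => w; rewrite /g rmorph_sum /= big_distrlr /= pair_big /=.
  apply: eq_bigr => -[r s] _ /=.
  have -> : (b s * (gamma s w)%:C%C)^*%C = (b s)^*%C * (gamma s w)%:C%C.
    by rewrite -[in RHS]conjc_real -[RHS]rmorphM.
  by rewrite mulrACA -[X in _ * X]rmorphM.
have [ig e] := cexpectation_lincomb (fun rs => a rs.1 * (b rs.2)^*%C) int_rs.
rewrite gE; split => //; rewrite e.
rewrite -(pair_big xpredT xpredT (fun r s => a r * (b s)^*%C *
  (fine 'E_P[fun w => gamma r w * gamma s w])%:C%C)) /=.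
apply: eq_bigr => r _; rewrite (bigD1 r)//= big1 ?addr0 => [|s sr].
  rewrite unlock; have [_ ->] := integral_iid_gaussianM r r gammaP.
  by rewrite eqxx mulr1.
rewrite unlock; have [_ ->] := integral_iid_gaussianM r s gammaP.
by rewrite eq_sym (negbTE sr) mulr0.
Qed.

End covariance.

Theorem proposition8 (R : realType) (q n : nat) (hq : (2 <= q)%N) (hn : (1 <= n)%N)
    (d0 : measure_display) (T0 : measurableType d0) (P0 : probability T0 R)
    (V : {RV P0 >-> site q n})
    (d1 : measure_display) (T1 : measurableType d1) (P1 : probability T1 R)
    (X Z : nat -> {RV P1 >-> site q n})
    (hX : random_walk V X Z)
    (d2 : measure_display) (T2 : measurableType d2) (P2 : probability T2 R)
    (gamma : site q n -> {RV P2 >-> R})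
    (hgamma : iid_standard_gaussian gamma)
    (alpha : R) (halpha : 0 < alpha < 1)
    (hrho : forall r : site q n, rho V r \is Num.real) :
  let g := gfield alpha (rho V) gamma in
  forall x y : site q n,
    [/\ cintegrable P2 (g x) /\ cintegrable P2 (fun w => g x w * (g y w)^*%C),
        ccovariance P2 (g x) (g y)
          = cexpectation P2 (fun w => g x w * (g y w)^*%C),
        (0 < P1 (X 0%N @^-1` [set x]))%E ->
          cexpectation P2 (fun w => g x w * (g y w)^*%C)
            = ((1 - alpha) * Green X alpha x y)%:C%C
      & cexpectation P2 (fun w => g x w * (g y w)^*%C)
          = ((q ^ n)%:R)^-1 *
            \sum_(r : site q n)
              (weight alpha (rho V r))^-1
              * theta1 R q ^ dot (zrep x - zrep y) (zrep r)].
Proof.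
move=> g x y.
(* g z is the combination of the gamma_r with coefficients c z r. *)
pose c x r := (sqrtC ((q ^ n)%:R : R[i]))^-1 *
  ((sqrtC (weight alpha (rho V r)))^-1 * chi R x r).
have gE z : g z = fun w => \sum_r c z r * (gamma r w)%:C%C.
  apply/funext => w; rewrite /g /gfield mulr_sumr.
  by apply: eq_bigr => r _; rewrite /c /chi !mulrA.
have [ix Ex] := gaussian_lincomb_mean hgamma (c x).
have [_ Ey] := gaussian_lincomb_mean hgamma (c y).
have [ixy Exy] := gaussian_lincomb_covariance hgamma (c x) (c y).
have covE : cexpectation P2 (fun w => g x w * (g y w)^*%C) =
    ((q ^ n)%:R)^-1 * \sum_r (weight alpha (rho V r))^-1 * chi R (x - y) r.
  rewrite !gE Exy mulr_sumr; apply: eq_bigr => r _.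
  have sqrt_real z : 0 <= z -> ((sqrtC z)^-1)^*%C = (sqrtC z)^-1 :> R[i].
    by move=> z0; rewrite conjc_ge0// invr_ge0 sqrtC_ge0.
  have sqrt_sqr z : (sqrtC z)^-1 * (sqrtC z)^-1 = z^-1 :> R[i].
    by rewrite -invfM -expr2 sqrtCK.
  rewrite /c !rmorphM /= !sqrt_real ?weight_ge0 ?norm_rho_le1// ?ler0n//.
  by rewrite conj_chi// mulrACA sqrt_sqr mulrACA sqrt_sqr -chiDl.
split.
- by rewrite !gE.
- by rewrite /ccovariance !gE Ex Ey; congr cexpectation;
  apply/funext => w; rewrite !subr0.
- by move=> Px; rewrite covE -(Green_fourier hq hX).
- rewrite covE; congr (_ * _); apply: eq_bigr => r _; congr (_ * _).
  rewrite chiDl// chiNl// /chi invr_expz -expfzDr ?theta1_neq0//.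
  congr (_ ^ _); rewrite /dot -sumrN -big_split; apply: eq_bigr => k _ /=.
  by rewrite !mxE mulrBl.
Qed.
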